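(* Let $n\le 5$ and let $\beta,\gamma\in B_n$ be positive permutation braids whose closures $\hat\beta$ and $\hat\gamma$ are both knots (each has exactly one component). Then $\beta$ and $\gamma$ are conjugate in $B_n$ if and only if they have the same number of crossings.
   Context: $B_n$ is Artin's braid group on $n$ strings, with generators $\sigma_1,\dots,\sigma_{n-1}$ and relations $\sigma_i\sigma_j=\sigma_j\sigma_i$ for $|i-j|\ge 2$ and $\sigma_i\sigma_{i+1}\sigma_i=\sigma_{i+1}\sigma_i\sigma_{i+1}$ for $1\le i\le n-2$. A positive braid is an element of $B_n$ which can be written as a word in positive powers of the generators $\sigma_i$, without inverses. A positive permutation braid is a positive braid in which no pair of strings crosses more than once. The number of crossings of a positive braid is the length of any positive word in the $\sigma_i$ representing it; equivalently its image under the homomorphism $wr:B_n\to\mathbf{Z}$ with $wr(\sigma_i)=1$ for all $i$. The closure $\hat\beta$ of a braid $\beta$ is the link in $S^3$ obtained by identifying the initial points of the strings with the corresponding end points. *)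

(* Defs.v *)
From HB Require Import structures.
From mathcomp Require Import all_boot all_order all_algebra all_fingroup.
From mathcomp Require Import boolp.

Set Implicit Arguments.
Unset Strict Implicit.
Unset Printing Implicit Defensive.

Import GRing.Theory.
Local Open Scope quotient_scope.

(* The generators sigma_1, ..., sigma_(n-1) are indexed from 0 by 'I_n.-1, and
   the n string positions from 0 by 'I_n: the generator i crosses the strings at
   positions i and i.+1, which are [lpos i] and [rpos i]. *)

Definition lpos n (i : 'I_n.-1) : 'I_n := widen_ord (leq_pred n) i.

Lemma rpos_subproof n (i : 'I_n.-1) : i.+1 < n.
Proof. by rewrite -ltn_predRL. Qed.

Definition rpos n (i : 'I_n.-1) : 'I_n := Ordinal (rpos_subproof i).

(* The letter (i, true) stands for sigma_i, the letter (i, false) for its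
   inverse. *)
Definition letter n := ('I_n.-1 * bool)%type.
Definition word n := seq (letter n).

Definition inv_letter n (x : letter n) : letter n := (x.1, ~~ x.2).

Definition inv_word n (w : word n) : word n := rev (map (@inv_letter n) w).

Inductive braid_rel n : word n -> word n -> Prop :=
| braid_rel_refl w : braid_rel w w
| braid_rel_sym u v : braid_rel u v -> braid_rel v u
| braid_rel_trans u v w : braid_rel u v -> braid_rel v w -> braid_rel u w
| braid_rel_cat u u' v v' :
    braid_rel u u' -> braid_rel v v' -> braid_rel (u ++ v) (u' ++ v')
| braid_rel_inv x : braid_rel [:: x; inv_letter x] [::]
| braid_rel_far (i j : 'I_n.-1) : i.+1 < j ->
    braid_rel [:: (i, true); (j, true)] [:: (j, true); (i, true)]
| braid_rel_near (i j : 'I_n.-1) : j = i.+1 :> nat ->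
    braid_rel [:: (i, true); (j, true); (i, true)]
              [:: (j, true); (i, true); (j, true)].

Definition braid_relb n : rel (word n) := fun u v => `[< braid_rel u v >].

Lemma braid_relb_refl n : reflexive (@braid_relb n).
Proof. by move=> w; apply/asboolP; apply: braid_rel_refl. Qed.

Lemma braid_relb_sym n : symmetric (@braid_relb n).
Proof.
by move=> u v; apply/asboolP/asboolP; apply: braid_rel_sym.
Qed.

Lemma braid_relb_trans n : transitive (@braid_relb n).
Proof.
move=> v u w /asboolP uv /asboolP vw.
by apply/asboolP; apply: braid_rel_trans uv vw.
Qed.

Canonical braid_equiv n :=
  EquivRel (@braid_relb n) (@braid_relb_refl n) (@braid_relb_sym n)
           (@braid_relb_trans n).

Definition braid n := {eq_quot @braid_relb n}.

HB.instance Definition _ n := Choice.on (braid n).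
HB.instance Definition _ n := EqQuotient.on (braid n).

Definition braid_repr n (b : braid n) : word n := generic_quotient.repr b.

Definition braid_of n (w : word n) : braid n := \pi_(braid n) w.

Lemma braid_ofP n (u v : word n) : braid_of u = braid_of v <-> braid_rel u v.
Proof.
split=> [/eqmodP/asboolP //|uv]; apply/eqmodP; exact/asboolP.
Qed.

Lemma braid_of_repr n (b : braid n) : braid_of (braid_repr b) = b.
Proof. exact: reprK. Qed.

Lemma repr_braid_of n (w : word n) : braid_rel (braid_repr (braid_of w)) w.
Proof. by apply/braid_ofP; rewrite braid_of_repr. Qed.

Lemma inv_letterK n : involutive (@inv_letter n).
Proof. by case=> i s; rewrite /inv_letter /= negbK. Qed.

Lemma inv_word_cat n (u v : word n) :
  inv_word (u ++ v) = inv_word v ++ inv_word u.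
Proof. by rewrite /inv_word map_cat rev_cat. Qed.

Lemma inv_wordK n : involutive (@inv_word n).
Proof.
by move=> w; rewrite /inv_word map_rev revK (mapK (@inv_letterK n)).
Qed.

Lemma braid_rel_cancel n (w : word n) : braid_rel (w ++ inv_word w) [::].
Proof.
elim: w => [|x w IHw]; first exact: braid_rel_refl.
rewrite -cat1s inv_word_cat -catA (catA w).
apply: braid_rel_trans (braid_rel_inv x).
rewrite -[X in braid_rel _ X]/([:: x] ++ [::] ++ inv_word [:: x]).
by do 2?[apply: braid_rel_cat => //]; apply: braid_rel_refl.
Qed.

Lemma braid_rel_cancelV n (w : word n) : braid_rel (inv_word w ++ w) [::].
Proof. by rewrite -{2}[w]inv_wordK; apply: braid_rel_cancel. Qed.

Lemma braid_rel_inv_word n (u v : word n) :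
  braid_rel u v -> braid_rel (inv_word u) (inv_word v).
Proof.
move=> uv; have R := @braid_rel_refl n.
have h1 : braid_rel (inv_word u) (inv_word u ++ v ++ inv_word v).
  rewrite -{1}[inv_word u]cats0; apply: braid_rel_cat => //.
  exact/braid_rel_sym/braid_rel_cancel.
apply: braid_rel_trans h1 _; rewrite catA -{2}[inv_word v]cat0s.
apply: braid_rel_cat => //; apply: braid_rel_trans (braid_rel_cancelV u).
by apply: braid_rel_cat => //; apply: braid_rel_sym.
Qed.

Definition braid_one n : braid n := braid_of [::].
Definition braid_mul n (a b : braid n) : braid n :=
  braid_of (braid_repr a ++ braid_repr b).
Definition braid_inv n (a : braid n) : braid n :=
  braid_of (inv_word (braid_repr a)).

Lemma braid_mulE n (u v : word n) :
  braid_mul (braid_of u) (braid_of v) = braid_of (u ++ v).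
Proof. by apply/braid_ofP/braid_rel_cat; apply: repr_braid_of. Qed.

Lemma braid_invE n (u : word n) : braid_inv (braid_of u) = braid_of (inv_word u).
Proof. exact/braid_ofP/braid_rel_inv_word/repr_braid_of. Qed.

Lemma braid_mulA n : associative (@braid_mul n).
Proof.
move=> a b c; rewrite -[a]braid_of_repr -[b]braid_of_repr -[c]braid_of_repr.
by rewrite !braid_mulE catA.
Qed.

Lemma braid_1mul n : left_id (braid_one n) (@braid_mul n).
Proof. by move=> a; rewrite -[a]braid_of_repr braid_mulE. Qed.

Lemma braid_mul1 n : right_id (braid_one n) (@braid_mul n).
Proof. by move=> a; rewrite -[a]braid_of_repr braid_mulE cats0. Qed.

Lemma braid_mulV n : left_inverse (braid_one n) (@braid_inv n) (@braid_mul n).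
Proof.
move=> a; rewrite -[a]braid_of_repr braid_invE braid_mulE.
exact/braid_ofP/braid_rel_cancelV.
Qed.

Lemma braid_Vmul n : right_inverse (braid_one n) (@braid_inv n) (@braid_mul n).
Proof.
move=> a; rewrite -[a]braid_of_repr braid_invE braid_mulE.
exact/braid_ofP/braid_rel_cancel.
Qed.

HB.instance Definition _ n :=
  isGroup.Build (braid n) (@braid_mulA n) (@braid_1mul n) (@braid_mul1 n)
    (@braid_mulV n) (@braid_Vmul n).

Local Open Scope group_scope.

Definition sigma n (i : 'I_n.-1) : braid n := braid_of [:: (i, true)].

Lemma braid_of_cat n (u v : word n) :
  braid_of (u ++ v) = braid_of u * braid_of v.
Proof. by rewrite -braid_mulE. Qed.

Lemma sigma_far n (i j : 'I_n.-1) : i.+1 < j ->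
  sigma i * sigma j = sigma j * sigma i.
Proof.
by move=> ij; rewrite -!braid_of_cat; apply/braid_ofP/braid_rel_far.
Qed.

Lemma sigma_near n (i j : 'I_n.-1) : j = i.+1 :> nat ->
  sigma i * sigma j * sigma i = sigma j * sigma i * sigma j.
Proof.
move=> ij; rewrite -[sigma i * sigma j]braid_of_cat.
rewrite -[sigma j * sigma i]braid_of_cat -[LHS]braid_of_cat -[RHS]braid_of_cat.
exact/braid_ofP/braid_rel_near.
Qed.

(* Positive words are sequences of generators. *)
Definition positive_braid_of n (w : seq 'I_n.-1) : braid n :=
  \prod_(i <- w) sigma i.

(* The pairs of strings crossed by the successive letters of a positive word,
   with multiplicity: a pair of strings crosses as many times as it occurs. A
   string is named by its initial position, and [s] sends each string to the
   position it has reached. *)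
Fixpoint crossings n (s : 'S_n) (w : seq 'I_n.-1) : seq {set 'I_n} :=
  if w is i :: w' then
    [set s^-1 (lpos i); s^-1 (rpos i)] ::
      crossings (s * tperm (lpos i) (rpos i)) w'
  else [::].

Definition positive_permutation_braid n (b : braid n) : Prop :=
  exists2 w : seq 'I_n.-1, b = positive_braid_of w & uniq (crossings 1 w).

Definition word_writhe n (w : word n) : int :=
  (\sum_(x <- w) (-1) ^+ (~~ x.2))%R.

(* The homomorphism B_n -> Z sending every generator to 1. On a positive braid it
   is the length of any positive word, hence the number of crossings. *)
Definition writhe n (b : braid n) : int := word_writhe (braid_repr b).

Lemma word_writhe_cat n (u v : word n) :
  word_writhe (u ++ v) = (word_writhe u + word_writhe v)%R.
Proof. exact: big_cat. Qed.

Lemma word_writhe_rel n (u v : word n) :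
  braid_rel u v -> word_writhe u = word_writhe v.
Proof.
elim=> {u v} [//|u v _ ->//|u v w _ -> _ ->//|u u' v v' _ Eu _ Ev|x|i j _|i j _].
- by rewrite !word_writhe_cat Eu Ev.
- by rewrite /word_writhe !big_cons big_nil /=; case: x.2.
- by rewrite /word_writhe !big_cons.
- by rewrite /word_writhe !big_cons.
Qed.

Lemma writheM n (a b : braid n) : writhe (a * b) = (writhe a + writhe b)%R.
Proof.
by rewrite -word_writhe_cat; apply: word_writhe_rel (repr_braid_of _).
Qed.

Lemma writhe_sigma n (i : 'I_n.-1) : writhe (sigma i) = 1%R.
Proof.
rewrite /writhe (word_writhe_rel (repr_braid_of _)).
by rewrite /word_writhe big_cons big_nil addr0.
Qed.

Lemma writhe_positive n (w : seq 'I_n.-1) :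
  writhe (positive_braid_of w) = Posz (size w).
Proof.
rewrite /positive_braid_of; elim: w => [|i w IHw].
  by rewrite big_nil /writhe (word_writhe_rel (repr_braid_of _)) /word_writhe
             big_nil.
by rewrite big_cons writheM writhe_sigma IHw.
Qed.

Definition word_perm n (w : word n) : 'S_n :=
  \prod_(x <- w) tperm (lpos x.1) (rpos x.1).

(* [string_end b x] is the final position of the string of b which starts at
   position x. *)
Definition string_end n (b : braid n) : 'S_n := word_perm (braid_repr b).

Lemma word_perm_cat n (u v : word n) :
  word_perm (u ++ v) = word_perm u * word_perm v.
Proof. exact: big_cat. Qed.

Lemma word_perm_rel n (u v : word n) :
  braid_rel u v -> word_perm u = word_perm v.
Proof.
elim=> {u v} [//|u v _ ->//|u v w _ -> _ ->//|u u' v v' _ Eu _ Ev|x|i j ij|i j ij].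
- by rewrite !word_perm_cat Eu Ev.
- by rewrite /word_perm !big_cons big_nil /= mulg1 tperm2.
- rewrite /word_perm !big_cons big_nil /= !mulg1.
  have [n1 n2 n3 n4] : [/\ lpos i != lpos j, rpos i != lpos j,
                           lpos i != rpos j & rpos i != rpos j].
    by split; rewrite -val_eqE /= ltn_eqF // ?ltnS ltnW // ltnW.
  apply/commgP/conjg_fixP; rewrite tpermJ !tpermD // eq_sym //.
- rewrite /word_perm !big_cons big_nil /= !mulg1.
  have -> : lpos j = rpos i by apply: val_inj.
  have n1 : lpos i != rpos i by rewrite -val_eqE /= ltn_eqF.
  have n2 : rpos i != rpos j by rewrite -val_eqE /= ij ltn_eqF.
  have n3 : lpos i != rpos j by rewrite -val_eqE /= ij ltn_eqF // ltnW.
  have conjE p q r t : tperm p q * (tperm r t * tperm p q) =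
      tperm r t ^ tperm p q :> 'S_n by rewrite /conjg tpermV.
  by rewrite !conjE !tpermJ tpermR tpermL !tpermD // eq_sym.
Qed.

Lemma string_endM n (a b : braid n) :
  string_end (a * b) = string_end a * string_end b.
Proof.
by rewrite -word_perm_cat; apply: word_perm_rel (repr_braid_of _).
Qed.

Lemma string_end_sigma n (i : 'I_n.-1) :
  string_end (sigma i) = tperm (lpos i) (rpos i).
Proof.
rewrite /string_end (word_perm_rel (repr_braid_of _)).
by rewrite /word_perm big_cons big_nil mulg1.
Qed.

(* In the closure, the end point of the string x is identified with the initial
   point of the string y when they have the same position. *)
Definition closure_glue n (b : braid n) : rel 'I_n :=
  fun x y => string_end b x == y.

(* The closure is the union of the n strings, which are arcs meeting only at
   the identified end points, so its components are the classes of strings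
   connected by the gluing. *)
Definition closure_components n (b : braid n) : nat :=
  n_comp (closure_glue b) predT.

Definition closure_is_knot n (b : braid n) : Prop := closure_components b = 1%N.

(* Main.v *)
(* The closure of a braid is a knot exactly when the permutation of its strings
   is an n-cycle.  For n <= 5 the positive words without repeated crossings that
   induce an n-cycle are finitely many, because each of the 'C(n, 2) pairs of
   strings crosses at most once.  It turns out that, among those of a given
   length, any two are joined by a chain of braid relations between positive words
   and of rotations [i :: u ~> rcons u i], and a rotation is a conjugation by
   sigma_i.  This connectedness is checked by computation. *)

Require Import Defs.
From mathcomp Require Import all_boot all_order all_algebra all_fingroup.

Set Implicit Arguments.
Unset Strict Implicit.
Unset Printing Implicit Defensive.

Import GRing.Theory.
Local Open Scope group_scope.

(** * Graph search on words *)

Section WordGraph.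

Variable m : nat.

(* Letters are to be read as generators only below [m]: the braid relation needs
   both of its letters in range, while far commutation holds regardless. *)
Fixpoint braid_moves (u : seq nat) : seq (seq nat) :=
  if u is i :: v then
    (if v is j :: v' then
       (if (i.+1 < j) || (j.+1 < i) then [:: [:: j, i & v']] else [::]) ++
       (if v' is k :: v'' then
          if [&& k == i, (j == i.+1) || (i == j.+1), i < m & j < m]
          then [:: [:: j, i, j & v'']] else [::]
        else [::])
     else [::]) ++ map (cons i) (braid_moves v)
  else [::].

Definition word_moves (u : seq nat) : seq (seq nat) := rot 1 u :: braid_moves u.

Fixpoint connected_from (fuel : nat) (todo pool : seq (seq nat)) : bool :=
  match pool, fuel, todo with
  | [::], _, _ => true
  | _, fuel'.+1, u :: todo' =>
      let near := mem (word_moves u) in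
      connected_from fuel' (filter near pool ++ todo')
                     (filter (predC near) pool)
  | _, _, _ => false
  end.

Definition word_connected (ws : seq (seq nat)) : bool :=
  connected_from (size ws) (take 1 ws) (behead ws).

Lemma connected_from_sound (P : seq nat -> Prop) fuel todo pool :
    (forall u v, v \in word_moves u -> P u -> P v) ->
    connected_from fuel todo pool -> {in todo, forall u, P u} ->
  {in pool, forall u, P u}.
Proof.
move=> Pmoves; elim: fuel todo pool => [|fuel IHfuel] todo [|v pool] //.
case: todo => // u todo conn Ptodo w w_pool.
have Pu : P u by apply: Ptodo; rewrite mem_head.
have [w_near|w_far] := boolP (w \in word_moves u); first exact: Pmoves Pu.
apply: (IHfuel _ _ conn) => [x|]; last by rewrite mem_filter /= w_far.
rewrite mem_cat mem_filter => /orP[/andP[x_near _]|x_todo].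
  exact: Pmoves Pu.
by apply: Ptodo; rewrite inE x_todo orbT.
Qed.

(** Moves are followed forwards from the head of the list, so a property that they preserve spreads
    from there to every word. It serves with [P] being conjugacy to a fixed braid. *)
Lemma word_connected_sound (P : seq nat -> Prop) ws u v :
    (forall u v, v \in word_moves u -> P u -> P v) ->
  word_connected ws -> u = head [::] ws -> P u -> v \in ws -> P v.
Proof.
case: ws => [//|x ws] Pmoves conn /= -> Px; rewrite inE => /predU1P[->//|].
apply: (connected_from_sound Pmoves conn) => y.
by rewrite /= take0 inE => /eqP->.
Qed.

End WordGraph.

(** * Words as braids, moves as conjugations *)

Section NatWords.

Variable n : nat.

(** An index out of range denotes the trivial braid, which commutes with everything. *)
Definition nat_sigma (i : nat) : braid n :=
  if insub i is Some j then sigma (j : 'I_n.-1) else 1.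

Definition nat_braid (u : seq nat) : braid n := \prod_(i <- u) nat_sigma i.

Lemma nat_sigma_ord (i : 'I_n.-1) : nat_sigma i = sigma i.
Proof. by rewrite /nat_sigma valK. Qed.

Lemma nat_braid_val (w : seq 'I_n.-1) :
  nat_braid (map val w) = positive_braid_of w.
Proof.
by rewrite /nat_braid big_map; apply: eq_bigr => i _; apply: nat_sigma_ord.
Qed.

Lemma nat_braid_cons i u : nat_braid (i :: u) = nat_sigma i * nat_braid u.
Proof. exact: big_cons. Qed.

Lemma nat_sigma_far i j : i.+1 < j ->
  nat_sigma i * nat_sigma j = nat_sigma j * nat_sigma i.
Proof.
move=> ij; rewrite /nat_sigma; case: insubP => [i' _ i'E|_]; last first.
  by rewrite mul1g mulg1.
case: insubP => [j' _ j'E|_]; last by rewrite mul1g mulg1.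
by apply: sigma_far; rewrite i'E j'E.
Qed.

Lemma nat_sigma_near i : i.+1 < n.-1 ->
  nat_sigma i * nat_sigma i.+1 * nat_sigma i =
  nat_sigma i.+1 * nat_sigma i * nat_sigma i.+1.
Proof.
move=> lt_i1; have lt_i := ltnW lt_i1.
by rewrite -[i]/(val (Ordinal lt_i)) -[(val _).+1]/(val (Ordinal lt_i1))
           !nat_sigma_ord; apply: sigma_near.
Qed.

Lemma braid_moves_eq u v :
  v \in braid_moves n.-1 u -> nat_braid v = nat_braid u.
Proof.
elim: u v => [//|i u IHu] v /=; rewrite mem_cat => /orP[|/mapP[v' v'P ->]].
  case: u {IHu} => [//|j u]; rewrite mem_cat => /orP[].
    case: ifP => // ij; rewrite inE => /eqP->.
    rewrite !nat_braid_cons !mulgA; congr (_ * _).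
    by case/orP: ij => /nat_sigma_far.
  case: u => [//|k u]; case: ifP => // /and4P[/eqP-> ij lt_i lt_j].
  rewrite inE => /eqP->; rewrite !nat_braid_cons !mulgA; congr (_ * _).
  by case/orP: ij lt_i lt_j => /eqP-> lt_i lt_j; rewrite nat_sigma_near.
by rewrite !nat_braid_cons (IHu _ v'P).
Qed.

(** Conjugating by the first generator carries it from the front of the word to the end. *)
Lemma nat_braid_rot1 u : exists g, nat_braid (rot 1 u) = nat_braid u ^ g.
Proof.
case: u => [|i u]; first by exists 1; rewrite conjg1.
exists (nat_sigma i); rewrite rot1_cons /nat_braid -cats1 big_cat /=.
by rewrite !big_cons big_nil mulg1 conjgE !mulgA mulVg mul1g.
Qed.

Lemma word_moves_conj b u v : v \in word_moves n.-1 u ->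
    (exists g, nat_braid u = b ^ g) ->
  exists g, nat_braid v = b ^ g.
Proof.
rewrite inE => /predU1P[->|/braid_moves_eq->//] [g ug].
by have [h ->] := nat_braid_rot1 u; exists (g * h); rewrite ug conjgM.
Qed.

End NatWords.

(** * Enumeration of words without repeated crossings *)

(* Below, [q] lists the strings by their present position. *)
Definition swap_at (q : seq nat) (i : nat) : seq nat :=
  mkseq (fun k => nth 0 q (if k == i then i.+1 else if k == i.+1 then i else k))
        (size q).

Definition crossing_pair (q : seq nat) (i : nat) : nat * nat :=
  let a := nth 0 q i in let b := nth 0 q i.+1 in
  if a < b then (a, b) else (b, a).

(** When [q] lists a permutation, it is a single cycle exactly when 0 does not return to itself in
    fewer than [size q] steps. *)
Definition is_cycle (q : seq nat) : bool :=
  all (fun k => iter k (nth 0 q) 0 != 0) (iota 1 (size q).-1).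

(** Depth-first enumeration, where a branch is cut as soon as it crosses again a pair in [seen]. *)
Fixpoint cyclic_words (m k : nat) (q : seq nat) (seen : seq (nat * nat)) :
    seq (seq nat) :=
  if k is k'.+1 then
    flatten [seq (let p := crossing_pair q i in
                  if p \in seen then [::]
                  else map (cons i) (cyclic_words m k' (swap_at q i) (p :: seen)))
            | i <- iota 0 m]
  else if is_cycle q then [:: [::]] else [::].

Definition knot_words (n k : nat) : seq (seq nat) :=
  cyclic_words n.-1 k (iota 0 n) [::].

Section Enumeration.

Variable n : nat.
Implicit Types (s : 'S_n) (w : seq 'I_n.-1) (q : seq nat).

(** [s] sends strings to positions, while the list is indexed by position: hence the inverse. *)
Definition arrangement s : seq nat := [seq val (s^-1 j) | j <- enum 'I_n].

Lemma size_arrangement s : size (arrangement s) = n.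
Proof. by rewrite size_map size_enum_ord. Qed.

Lemma nth_arrangement s (j : 'I_n) : nth 0 (arrangement s) j = s^-1 j.
Proof. by rewrite (nth_map j) ?size_enum_ord // nth_ord_enum. Qed.

Lemma arrangement1 : arrangement 1 = iota 0 n.
Proof.
by rewrite -val_enum_ord; apply: eq_map => j; rewrite invg1 perm1.
Qed.

Lemma arrangement_swap s (i : 'I_n.-1) :
  arrangement (s * tperm (lpos i) (rpos i)) = swap_at (arrangement s) i.
Proof.
apply: (@eq_from_nth _ 0) => [|k]; rewrite ?size_mkseq !size_arrangement //.
move=> lt_k; rewrite nth_mkseq ?size_arrangement //.
rewrite -[k in LHS]/(val (Ordinal lt_k)) nth_arrangement invMg tpermV permM.
rewrite -nth_arrangement; congr nth.
case: tpermP => [/(congr1 val)/= <-|/(congr1 val)/= ->|/eqP kl /eqP kr] /=.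
- by rewrite eqxx.
- by rewrite eqn_leq ltnn eqxx.
- by rewrite -!val_eqE /= in kl kr; rewrite (negPf kl) (negPf kr).
Qed.

Definition pair_set (p : nat * nat) : {set 'I_n} :=
  [set j : 'I_n | (val j == p.1) || (val j == p.2)].

Lemma crossing_pairE s (i : 'I_n.-1) :
  pair_set (crossing_pair (arrangement s) i) = [set s^-1 (lpos i); s^-1 (rpos i)].
Proof.
rewrite /crossing_pair -[nat_of_ord i]/(val (lpos i)).
rewrite -[(val (lpos i)).+1]/(val (rpos i)) !nth_arrangement.
by apply/setP=> j; rewrite !inE -!val_eqE; case: ifP => _ //=; apply: orbC.
Qed.

Lemma crossings_card s w : {in crossings s w, forall A : {set 'I_n}, #|A| = 2}.
Proof.
elim: w s => [//|i w IHw] s A; rewrite inE => /predU1P[->|/IHw//].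
by rewrite cards2 (inj_eq perm_inj) -val_eqE /= neq_ltn leqnn.
Qed.

Lemma size_crossings s w : size (crossings s w) = size w.
Proof. by elim: w s => //= i w IHw s; rewrite IHw. Qed.

(** The crossings are distinct two-element subsets of the n strings. *)
Lemma size_uniq_crossings s w : uniq (crossings s w) -> size w <= 'C(n, 2).
Proof.
move=> w_uniq; rewrite -(size_crossings s) -(card_uniqP w_uniq).
rewrite -[n in leqRHS]card_ord -card_draws subset_leq_card //.
by apply/subsetP=> A /crossings_card cardA; rewrite inE cardA.
Qed.

Definition word_end w : 'S_n := \prod_(i <- w) tperm (lpos i) (rpos i).

(** Completeness of the enumeration. The invariant is that what remains of the word crosses no pair
    in [seen]. *)
Lemma mem_cyclic_words s w seen :
    uniq (crossings s w) ->
    {in seen, forall p, pair_set p \notin crossings s w} ->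
    is_cycle (arrangement (s * word_end w)) ->
  map val w \in cyclic_words n.-1 (size w) (arrangement s) seen.
Proof.
elim: w s seen => [|i w IHw] s seen /=.
  by rewrite /word_end big_nil mulg1 => _ _ ->.
rewrite /word_end big_cons mulgA => /andP[i_new w_uniq] seen_new cyc.
have i_mem : val i \in iota 0 n.-1 by rewrite mem_iota /=.
apply/flattenP; eexists; first exact: (map_f _ i_mem).
rewrite /=; case: ifP => [/seen_new|_]; first by rewrite crossing_pairE mem_head.
apply: map_f; rewrite -arrangement_swap; apply: IHw => // p.
rewrite inE => /predU1P[->|/seen_new]; first by rewrite crossing_pairE.
by rewrite inE negb_or => /andP[].
Qed.

Lemma iter_arrangement s k (x : 'I_n) :
  iter k (nth 0 (arrangement s)) x = (s^-1 ^+ k) x.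
Proof.
elim: k => [|k IHk]; first by rewrite perm1.
by rewrite iterS IHk nth_arrangement expgSr permM.
Qed.

(** All points share one root, so the orbit of [x] is everything. *)
Lemma n_comp1_order s (x : 'I_n) : n_comp (frel s) predT = 1%N -> fingraph.order s x = n.
Proof.
move=> /eqP/card1P/= [r rP]; rewrite -[RHS]card_ord; apply: eq_card => y.
have root_r z : froot s z = r.
  apply/eqP; have := rP (froot s z); rewrite !inE andbT => <-.
  exact/roots_root/fconnect_sym/perm_inj.
by rewrite inE -topredE /= -(root_connect (fconnect_sym perm_inj)) !root_r eqxx.
Qed.

Lemma knot_is_cycle s :
  n_comp (frel s) predT = 1%N -> is_cycle (arrangement s).
Proof.
move=> s_knot; apply/allP=> k; rewrite mem_iota size_arrangement add1n.
case/andP=> k_gt0; rewrite ltnS => k_le.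
have lt_kn : k < n by case: (n) k_le; first by rewrite leqNgt k_gt0.
have n_gt0 : 0 < n by apply: leq_ltn_trans lt_kn.
pose x : 'I_n := Ordinal n_gt0; rewrite -[X in iter _ _ X]/(val x).
rewrite iter_arrangement -[X in _ != X]/(val x) val_eqE; apply/eqP=> xk.
(* The arrangement iterates [s^-1]; a return of [s^-1] after k steps is also one of [s]. *)
have: iter k s x = x by rewrite -permX -[in LHS]xk expVgn permKV.
move/(congr1 (findex s x)); rewrite findex0 findex_iter ?n_comp1_order //.
by move=> k0; rewrite k0 in k_gt0.
Qed.

End Enumeration.

(** * The finite check and the conjugacy criterion *)

Lemma string_end_positive n (w : seq 'I_n.-1) :
  string_end (positive_braid_of w) = word_end w.
Proof.
rewrite /positive_braid_of /word_end; elim: w => [|i w IHw]; last first.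
  by rewrite !big_cons string_endM string_end_sigma IHw.
(* [string_end 1] equals its own square, hence is the identity. *)
rewrite !big_nil; apply: (mulgI (string_end 1)).
by rewrite -string_endM !mulg1.
Qed.

Lemma ppb_knot_word n (b : braid n) :
    positive_permutation_braid b -> closure_is_knot b ->
  exists u, [/\ b = nat_braid n u, size u <= 'C(n, 2),
                u \in knot_words n (size u) & writhe b = Posz (size u)].
Proof.
case=> w -> w_uniq w_knot; exists (map val w).
rewrite nat_braid_val size_map writhe_positive (size_uniq_crossings w_uniq).
split=> //; rewrite /knot_words -arrangement1.
apply: mem_cyclic_words => //; rewrite mul1g -string_end_positive.
exact: knot_is_cycle.
Qed.

Lemma knot_words_connected n k : n <= 5 -> k <= 'C(n, 2) ->
  word_connected n.-1 (knot_words n k).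
Proof.
move=> n_le5; rewrite -ltnS -[k < _](mem_iota 0).
apply/allP: k; move: n n_le5.
have: all (fun n => all (fun k => word_connected n.-1 (knot_words n k))
                        (iota 0 'C(n, 2).+1)) (iota 0 6) by vm_compute.
by move/allP=> check n n_le5; apply: check; rewrite mem_iota.
Qed.

Theorem theorem4 (n : nat) (n_le5 : (n <= 5)%N) (beta gamma : braid n)
    (beta_ppb : positive_permutation_braid beta)
    (gamma_ppb : positive_permutation_braid gamma)
    (beta_knot : closure_is_knot beta)
    (gamma_knot : closure_is_knot gamma) :
  (exists g : braid n, gamma = (beta ^ g)%g) <-> writhe beta = writhe gamma.
Proof.
split=> [[g ->]|].
  (* The writhe takes values in a commutative group, so conjugation preserves it. *)
  by rewrite conjgE writheM addrC -writheM -mulgA mulgV mulg1.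
have [u [-> u_le u_mem ->]] := ppb_knot_word beta_ppb beta_knot.
have [v [-> _ v_mem ->]] := ppb_knot_word gamma_ppb gamma_knot.
case=> uv; rewrite -uv in v_mem.
have conn := knot_words_connected n_le5 u_le.
(* The first enumerated word is the base to which both braids are compared. *)
pose b := nat_braid n (head [::] (knot_words n (size u))).
have conj_b w : w \in knot_words n (size u) -> exists g, nat_braid n w = b ^ g.
  move=> w_mem; pose P x := exists g, nat_braid n x = b ^ g.
  apply: (@word_connected_sound _ P) conn erefl _ w_mem => [x y|].
    exact: word_moves_conj.
  by exists 1; rewrite conjg1.
have [g ->] := conj_b u u_mem; have [h ->] := conj_b v v_mem.
by exists (g^-1 * h); rewrite -conjgM mulKVg.
Qed.
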